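(* Let $Y$ be a subspace of a topological space $X$. Then $Y$ is an $L$-retract of $X$ if and only if there is a continuous linear extender $\phi: C_p(Y)\to C_p(X)$ such that whenever $B\subset C(Y)$ is an equicontinuous pointwise bounded set, $\phi(B)$ is also an equicontinuous pointwise bounded set (in $C(X)$).
   Context: All topological spaces are Tychonoff; all locally convex spaces are real and Hausdorff. $C(X)$ is the set of continuous real functions on $X$ and $C_p(X)$ is $C(X)$ with the topology of pointwise convergence. An extender is a mapping $\phi: C(Y)\to C(X)$ with $\phi(f)|Y=f$ for all $f\in C(Y)$. The free locally convex space $L(X)$ over $X$ is a locally convex space with a continuous injection $\delta_X: X\to L(X)$ such that $L(X)$ is the linear span of $\delta_X(X)$ and every continuous $f: X\to E$ to a locally convex space $E$ satisfies $f=f_\#\circ\delta_X$ for a (unique) continuous linear $f_\#: L(X)\to E$. It exists and is unique up to topological isomorphism, $\delta_X$ is a closed topological embedding, and $\delta_X(X)$ is a Hamel basis; $X$ is identified with $\delta_X(X)$. For $Y\subset X$, $L(Y)$ (with its own free topology) is identified as a vector space with the linear span of $Y$ in $L(X)$; $Y$ is $L$-embedded in $X$ if the topology of $L(Y)$ is the subspace topology from $L(X)$. $Y$ is an $L$-retract of $X$ if $Y$ is $L$-embedded in $X$ and there is a continuous linear retraction $r: L(X)\to L(Y)$ (that is, $r$ is the identity on $L(Y)$). *)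

(* Defs.v *)
From HB Require Import structures.
From mathcomp Require Import all_boot all_order all_algebra.
From mathcomp Require Import all_classical all_reals all_analysis.

Set Implicit Arguments.
Unset Strict Implicit.
Unset Printing Implicit Defensive.

Import Order.TTheory GRing.Theory Num.Theory.
Import numFieldNormedType.Exports.

Local Open Scope classical_set_scope.
Local Open Scope ring_scope.

Definition tychonoff_space (X : topologicalType) : Prop :=
  hausdorff_space X /\ completely_regular_space X.

(* The set C(X); its topology, declared below, is that of pointwise
   convergence, so that this type also denotes C_p(X). *)
Definition Cp (R : realType) (X : topologicalType) : Type := continuousType X R.

Section Cp_structure.
Context (R : realType) (X : topologicalType).
Implicit Types f g h : Cp R X.

HB.instance Definition _ := Choice.on (Cp R X).

Definition Cp_fun f : {ptws X -> R} := f.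

Lemma Cp_funP f g : (forall x, f x = g x) <-> f = g.
Proof. by split=> [fg|->//]; apply/continuousEP => x; exact: fg. Qed.

Lemma Cp_zero_subproof : continuous (fun _ : X => 0 : R).
Proof. exact: cst_continuous. Qed.

Lemma Cp_add_subproof f g : continuous (fun x => f x + g x).
Proof. by move=> x; apply: cvgD; exact: cts_fun. Qed.

Lemma Cp_opp_subproof f : continuous (fun x => - f x).
Proof. by move=> x; apply: cvgN; exact: cts_fun. Qed.

Lemma Cp_scale_subproof (a : R) f : continuous (fun x => a * f x).
Proof. by move=> x; apply: cvgMl_tmp; exact: cts_fun. Qed.

Definition Cp_zero : Cp R X := mkcts Cp_zero_subproof.
Definition Cp_add f g : Cp R X := mkcts (@Cp_add_subproof f g).
Definition Cp_opp f : Cp R X := mkcts (@Cp_opp_subproof f).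
Definition Cp_scale (a : R) f : Cp R X := mkcts (@Cp_scale_subproof a f).

Fact Cp_addA : associative Cp_add.
Proof. by move=> f g h; apply/Cp_funP => x; rewrite /= /mkcts/= addrA. Qed.
Fact Cp_addC : commutative Cp_add.
Proof. by move=> f g; apply/Cp_funP => x; rewrite /= /mkcts/= addrC. Qed.
Fact Cp_add0 : left_id Cp_zero Cp_add.
Proof. by move=> f; apply/Cp_funP => x; rewrite /= /mkcts/= add0r. Qed.
Fact Cp_addN : left_inverse Cp_zero Cp_opp Cp_add.
Proof. by move=> f; apply/Cp_funP => x; rewrite /= /mkcts/= addNr. Qed.

HB.instance Definition _ := GRing.isZmodule.Build (Cp R X)
  Cp_addA Cp_addC Cp_add0 Cp_addN.

Fact Cp_scaleA a b f : Cp_scale a (Cp_scale b f) = Cp_scale (a * b) f.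
Proof. by apply/Cp_funP => x; rewrite /= /mkcts/= mulrA. Qed.
Fact Cp_scale1 : left_id 1 Cp_scale.
Proof. by move=> f; apply/Cp_funP => x; rewrite /= /mkcts/= mul1r. Qed.
Fact Cp_scaleDr : right_distributive Cp_scale +%R.
Proof. by move=> a f g; apply/Cp_funP => x; rewrite /= /mkcts/= mulrDr. Qed.
Fact Cp_scaleDl f : {morph Cp_scale^~ f : a b / a + b}.
Proof. by move=> a b; apply/Cp_funP => x; rewrite /= /mkcts/= mulrDl. Qed.

HB.instance Definition _ := GRing.Zmodule_isLmodule.Build R (Cp R X)
  Cp_scaleA Cp_scale1 Cp_scaleDr Cp_scaleDl.

HB.instance Definition _ := Topological.copy (Cp R X) (initial_topology Cp_fun).

Definition equicontinuous_pointwise_bounded (B : set (Cp R X)) : Prop :=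
  equicontinuous B Cp_fun /\
  forall x : X, bounded_set ((fun f : Cp R X => f x) @` B).

End Cp_structure.

(* A free locally convex space over X.  The universal property ranges over real
   Hausdorff locally convex spaces; uniqueness of the linear extension follows
   from free_span. *)
Record free_lcs (R : realType) (X : topologicalType) := FreeLcs {
  free_space :> tvsType R;
  free_delta : X -> free_space;
  free_hausdorff : hausdorff_space free_space;
  free_delta_continuous : continuous free_delta;
  free_delta_inj : injective free_delta;
  free_span : forall u : free_space,
    exists s : seq (R * X), u = \sum_(p <- s) p.1 *: free_delta p.2;
  free_universal : forall (E : tvsType R), hausdorff_space E ->
    forall f : X -> E, continuous f ->
    exists2 g : {linear free_space -> E},
      continuous g & forall x, g (free_delta x) = f x
}.

Section L_retract.
Context (R : realType) (X : topologicalType) (Y : set X).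
Context (LX : free_lcs R X) (LY : free_lcs R (set_type Y)).

Lemma L_incl_subproof :
  continuous (fun y : set_type Y => free_delta LX (set_val y)).
Proof.
move=> y; apply: (@continuous_comp _ _ _ (set_val : set_type Y -> X)).
  exact: initial_continuous.
exact: free_delta_continuous.
Qed.

(* The linear map L(Y) -> L(X) which realizes the identification of L(Y) with
   the linear span of Y in L(X). *)
Definition L_incl : {linear LY -> LX} :=
  sval (cid2 (free_universal LY (@free_hausdorff _ _ LX) L_incl_subproof)).

Lemma L_incl_delta (y : set_type Y) :
  L_incl (free_delta LY y) = free_delta LX (set_val y).
Proof. by rewrite /L_incl; case: cid2. Qed.

Lemma L_incl_continuous : continuous L_incl.
Proof. by rewrite /L_incl; case: cid2. Qed.

Definition L_embedded : Prop :=
  injective L_incl /\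
  forall A : set LY, open A <-> open (A : set (initial_topology L_incl)).

Definition L_retract : Prop :=
  L_embedded /\
  exists2 r : {linear LX -> LY}, continuous r & cancel L_incl r.

End L_retract.

Definition extender (R : realType) (X : topologicalType) (Y : set X)
    (phi : Cp R (set_type Y) -> Cp R X) : Prop :=
  forall (f : Cp R (set_type Y)) (y : set_type Y), phi f (set_val y) = f y.

(* Main.v *)
Require Import Defs.
From HB Require Import structures.
From mathcomp Require Import all_boot all_order all_algebra.
From mathcomp Require Import all_classical all_reals all_analysis.
From mathcomp Require Import ring lra.
Import Order.TTheory GRing.Theory Num.Theory.
Import numFieldNormedType.Exports.


(** Restriction to the points of [X] identifies the continuous linear
functionals on [L(X)] with [C(X)]; [free_ext LX f] is the functional given by
[f].  Under this duality continuous linear maps [r : L(X) -> L(Y)] correspond,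
by transposition, to the linear maps [phi : C(Y) -> C(X)] with
[phi f x = free_ext LY f (r x)], and [r] is a retraction exactly when [phi] is
an extender.  What has to be matched is the continuity of the two maps.

Each [r x] is a finite combination of points of [Y], so [f |-> phi f x] is a
finite combination of evaluations; conversely [Cp_dual_finite] says that the
continuous linear functionals on [C_p(Y)] are such combinations, so a continuous
[phi] yields a map [r0 : X -> L(Y)].  Hence pointwise continuity of [phi] only
expresses that [r] takes its values in [L(Y)].

Continuity of [r] is governed by equicontinuity, because the topology of [L(Y)]
is that of uniform convergence on the equicontinuous pointwise bounded subsets
of [C(Y)].  This has two halves.

- If [B] is equicontinuous and pointwise bounded, then [free_ext LY f u] tends to
  [0] with [u], uniformly in [f] in [B] ([free_equicontinuous]).  Indeed
  [p u = sup_(f in B) `|free_ext LY f u|] is a seminorm for which [Y -> L(Y)] is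
  continuous, so [Y] still maps continuously into [L(Y)] with [p] added to its
  topology.  By the universal property the identity of [L(Y)] is continuous for
  this finer topology, that is, [p] is continuous
  ([free_seminorm_continuous]).

- If [V] is a convex neighbourhood of [0] in [L(Y)], then the functions [f] with
  [free_ext LY f <= 1] on [V] form an equicontinuous pointwise bounded set
  ([polar_equicontinuous_bounded]), and this set detects [V]: every [u] outside
  [V] has such an [f] with [free_ext LY f u >= 1] ([polar_separation]).  This is
  the Hahn-Banach theorem for the gauge of [V].

The first half shows that the transpose of a continuous [r] preserves
equicontinuous pointwise bounded sets.  The second one shows that [r0] is
continuous when [phi] preserves them: if [x'] is so close to [x] that
[phi f x' - phi f x < 1] for all [f] in the polar of [V], then
[r0 x' - r0 x] lies in [V].  So [r0] extends to [L(X)], and a continuous linear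
left inverse of [L(Y) -> L(X)] makes that map an embedding. *)

Set Implicit Arguments.
Unset Strict Implicit.
Unset Printing Implicit Defensive.

Local Open Scope classical_set_scope.
Local Open Scope ring_scope.

(** * Sublinear functionals and the Hahn-Banach theorem *)

Section sublinear_functionals.
Context (R : realType) (E : lmodType R).
Implicit Types (p q : E -> R) (x y z : E).

(** Only the inequality is asked of positive scalars, which is easier to verify
for infima; equality and [p 0 = 0] are [sublinear_scale] and [sublinear0]. *)
Definition sublinear p : Prop :=
  (forall x y, p (x + y) <= p x + p y) /\
  (forall (a : R) x, 0 < a -> p (a *: x) <= a * p x).

Lemma sublinear0 p : sublinear p -> p 0 = 0.
Proof.
move=> [pD pZ]; have := pD 0 0; have := pZ 2^-1 0.
rewrite scaler0 addr0 invr_gt0 ltr0n => /(_ isT); lra.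
Qed.

Lemma sublinear_scale p (a : R) x : sublinear p -> 0 < a -> p (a *: x) = a * p x.
Proof.
move=> [_ pZ] a0; apply/eqP; rewrite eq_le pZ//=.
rewrite -ler_pdivlMl// -{1}(scale1r x) -(mulVf (lt0r_neq0 a0)) -scalerA.
by rewrite pZ// invr_gt0.
Qed.

Lemma sublinear_lower p x : sublinear p -> - p (- x) <= p x.
Proof.
by move=> sp; have := sp.1 x (- x); rewrite subrr sublinear0//; lra.
Qed.

(** The three infima met below (slopes, lower bounds of chains, gauges) have no
more in common than this: sums and multiples of values at [x] and [y] dominate
some value at [x + y] and at [a *: x]. *)
Lemma inf_sublinear (S : E -> set R) :
  (forall x, has_inf (S x)) ->
  (forall x y s t, S x s -> S y t -> exists2 r, S (x + y) r & r <= s + t) ->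
  (forall a x s, 0 < a -> S x s -> exists2 r, S (a *: x) r & r <= a * s) ->
  sublinear (fun x => inf (S x)).
Proof.
move=> infS SD SZ; split=> [x y|a x a0].
  rewrite -lerBlDr; apply: lb_le_inf => [|s Sxs]; first exact: (infS x).1.
  rewrite lerBlDr -lerBlDl; apply: lb_le_inf => [|t Syt].
    exact: (infS y).1.
  have [r Sr rst] := SD _ _ _ _ Sxs Syt.
  rewrite lerBlDl (le_trans _ rst)//.
  exact: (ge_inf (infS _).2).
rewrite -ler_pdivrMl//; apply: lb_le_inf => [|s Sxs]; first exact: (infS x).1.
have [r Sr ras] := SZ _ _ _ a0 Sxs.
rewrite ler_pdivrMl// (le_trans _ ras)//; exact: (ge_inf (infS _).2).
Qed.

(** For [t > 0] the value at [t] is the difference quotient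
[(p (y + s *: x) - p y) / s] with [s = t^-1], and it decreases with [s] by
convexity: the infimum is the derivative of [p] at [y] in the direction [x].  It
stays below [p] and takes the value [- p y] at [- y]. *)
Definition slope_values p y x : set R :=
  [set p (x + t *: y) - t * p y | t in [set t | 0 <= t]].

Definition slope p y x : R := inf (slope_values p y x).

Lemma has_inf_slope_values p y x : sublinear p -> has_inf (slope_values p y x).
Proof.
move=> sp; split; first by exists (p (x + 0 *: y) - 0 * p y), 0 => //=.
exists (- p (- x)) => _ [t /= t0 <-].
have : t * p y <= p (x + t *: y) + p (- x).
  have [->|tn0] := eqVneq t 0.
    by rewrite scale0r mul0r addr0; have := sublinear_lower x sp; lra.
  rewrite -sublinear_scale//; last by rewrite lt_neqAle eq_sym tn0.
  by rewrite (le_trans _ (sp.1 _ _))// addrAC subrr add0r.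
lra.
Qed.

Lemma slope_le p y x t : sublinear p -> 0 <= t ->
  slope p y x <= p (x + t *: y) - t * p y.
Proof.
move=> sp t0; apply: (ge_inf (has_inf_slope_values y x sp).2).
by exists t.
Qed.

Lemma slope_sublinear p y : sublinear p -> sublinear (slope p y).
Proof.
move=> sp; apply: inf_sublinear => [x|x x' _ _ [t /= t0 <-] [t' /= t'0 <-]|].
- exact: has_inf_slope_values.
- exists (p (x + x' + (t + t') *: y) - (t + t') * p y).
    by exists (t + t') => //=; rewrite addr_ge0.
  rewrite scalerDl addrACA; have := sp.1 (x + t *: y) (x' + t' *: y); lra.
- move=> a x _ a0 [t /= t0 <-].
  exists (p (a *: x + (a * t) *: y) - (a * t) * p y).
    by exists (a * t) => //=; rewrite mulr_ge0// ltW.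
  by rewrite -scalerA -scalerDr mulrBr mulrA lerB// sp.2.
Qed.

Lemma slope_le_self p y x : sublinear p -> slope p y x <= p x.
Proof.
move=> sp; apply: (le_trans (slope_le y x sp (lexx 0))).
by rewrite scale0r mul0r addr0 subr0.
Qed.

Definition minimal_sublinear p : Prop :=
  sublinear p /\ forall q, sublinear q -> (forall x, q x <= p x) -> q = p.

(** [slope p y] is sublinear and below [p], so it equals [p] by minimality; the
term [t = 1] of the infimum then reads [p x <= p (x + y) - p y]. *)
Lemma minimal_sublinear_add p x y : minimal_sublinear p ->
  p (x + y) = p x + p y.
Proof.
move=> [sp pmin]; apply/eqP; rewrite eq_le sp.1/=.
have : slope p y x <= p (x + 1 *: y) - 1 * p y by exact: slope_le.
rewrite scale1r mul1r (pmin (slope p y)); first by lra.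
- exact: slope_sublinear.
- by move=> z; exact: slope_le_self.
Qed.

Lemma minimal_sublinear_linear p : minimal_sublinear p ->
  exists l : {linear E -> R^o}, forall x, l x = p x.
Proof.
move=> mp; have sp := mp.1; have pD := fun x y => minimal_sublinear_add x y mp.
have pN x : p (- x) = - p x.
  by have := pD x (- x); rewrite subrr sublinear0//; lra.
have pZ a x : p (a *: x) = a * p x.
  have [a0|a0|->] := ltgtP a 0; last by rewrite scale0r mul0r sublinear0.
  - by rewrite -[a]opprK scaleNr pN sublinear_scale ?oppr_gt0//
      !mulNr opprK.
  - exact: sublinear_scale.
have lin : linear_for *:%R (p : E -> R^o) by move=> a x y; rewrite pD pZ.
exists (HB.pack_for {linear E -> R^o} (p : E -> R^o)
  (GRing.isLinear.Build R E R^o *:%R (p : E -> R^o) lin)) => //.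
Qed.

(** Zorn's lemma: a chain has the pointwise infimum as a lower bound, finite
because every [q <= p] satisfies [q x >= - q (- x) >= - p (- x)]. *)
Lemma minimal_sublinear_exists p : sublinear p ->
  exists2 q, minimal_sublinear q & forall x, q x <= p x.
Proof.
move=> sp.
pose P (q : E -> R) := sublinear q /\ forall x, q x <= p x.
pose T := {q : E -> R | P q}.
pose dom (q r : T) : bool := `[< forall x, sval r x <= sval q x >].
have [|q r s /asboolP qr /asboolP rs|q r /asboolP qr /asboolP rq|A Atot|] :=
    @Zorn T dom.
- by move=> q; apply/asboolP.
- by apply/asboolP => x; exact: le_trans (rs x) (qr x).
- case: q r qr rq => [q hq] [r hr] /= qr rq; apply: eq_exist.
  by apply/funext => x; apply: le_anti; rewrite qr rq.
- have [->|/set0P [q0 Aq0]] := eqVneq A set0.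
    by exists (exist P p (conj sp (fun=> lexx _))).
  pose S x := [set sval q x | q in A].
  have infS x : has_inf (S x).
    split; first by exists (sval q0 x), q0.
    exists (- p (- x)) => _ [q _ <-].
    apply: le_trans (sublinear_lower x (svalP q).1).
    by rewrite lerN2; exact: (svalP q).2.
  have sinf : sublinear (fun x => inf (S x)).
    apply: inf_sublinear => // [x y _ _ [q Aq <-] [r Ar <-]|a x _ a0 [q Aq <-]].
      have [/asboolP qr|/asboolP rq] := Atot _ _ Aq Ar.
        exists (sval r (x + y)); first by exists r.
        by rewrite (le_trans ((svalP r).1.1 _ _))// lerD2r.
      exists (sval q (x + y)); first by exists q.
      by rewrite (le_trans ((svalP q).1.1 _ _))// lerD2l.
    by exists (sval q (a *: x)); [exists q|exact: (svalP q).1.2].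
  have infp x : inf (S x) <= p x.
    apply: le_trans ((svalP q0).2 x); apply: (ge_inf (infS x).2).
    by exists q0.
  exists (exist P _ (conj sinf infp)) => q Aq; apply/asboolP => x /=.
  by apply: (ge_inf (infS x).2); exists q.
- move=> [q [sq qp]] qmin; exists q => //; split=> // r sr rq.
  have rp x : r x <= p x by exact: le_trans (rq x) (qp x).
  have : exist P r (conj sr rp) = exist P q (conj sq qp).
    by apply: qmin; apply/asboolP.
  by move=> /(congr1 sval).
Qed.

(** A linear [l] below [slope p z] is below [p], and
[l (- z) <= slope p z (- z) <= p 0 - p z = - p z]. *)
Theorem hahn_banach p z : sublinear p ->
  exists2 l : {linear E -> R^o}, (forall x, l x <= p x) & p z <= l z.
Proof.
move=> sp; have [q mq qp] := minimal_sublinear_exists (slope_sublinear z sp).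
have [l lq] := minimal_sublinear_linear mq; exists l => [x|].
  by rewrite lq (le_trans (qp x))// slope_le_self.
have : l (- z) <= - p z.
  rewrite lq (le_trans (qp _))// (le_trans (slope_le z (- z) sp ler01))//.
  by rewrite scale1r mul1r addNr sublinear0// sub0r.
by rewrite linearN lerN2.
Qed.

End sublinear_functionals.

(** * Convex neighbourhoods and their polars *)

Section convex_neighbourhoods.
Context (R : realType) (E : tvsType R).
Implicit Types (V : set E) (x u v : E).

Lemma cvg_scale_sub (a : R) x : (fun v => a *: (v - x)) @ x --> (0 : E).
Proof.
have sub : (fun v => v - x) @ x --> (0 : E).
  rewrite -(subrr x).
  have h : (fun v : E => (v, - x)) @ x --> (x, - x).
    by apply: (@cvg_pair _ _ _ _ (nbhs x)); [exact: cvg_id|exact: cvg_cst].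
  exact: (cvg_comp _ _ h (@add_continuous E (x, - x))).
rewrite -(scaler0 E a).
have h : (fun v : E => (a : R^o, v - x)) @ x --> (a : R^o, 0 : E).
  by apply: (@cvg_pair _ _ _ _ (nbhs (a : R^o))); [exact: cvg_cst|exact: sub].
exact: (cvg_comp _ _ h (@scale_continuous R E (a, 0))).
Qed.

Lemma nbhs0_absorbing V x : nbhs 0 V -> exists2 t : R, 0 < t & V (t^-1 *: x).
Proof.
move=> V0; have : (fun a : R^o => a *: x) @ (0 : R^o) --> (0 : E).
  rewrite -[X in _ --> X](scale0r x).
  have h : (fun a : R^o => (a, x)) @ (0 : R^o) --> (0 : R^o, x).
    by apply: (@cvg_pair _ _ _ _ (nbhs (0 : R^o))); [exact: cvg_id|exact: cvg_cst].
  exact: (cvg_comp _ _ h (@scale_continuous R E (0, x))).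
move=> /(_ _ V0) /nbhs_ballP[e /= e0 eV].
exists (e / 2)^-1; first by rewrite invr_gt0 divr_gt0.
rewrite invrK; apply: eV; rewrite /ball/= sub0r normrN gtr0_norm ?divr_gt0//.
by rewrite ltr_pdivrMr// ltr_pMr// ltr1n.
Qed.

Lemma convex_comb V (a b : R) u v : convex_set V -> 0 <= a -> 0 <= b ->
  a + b = 1 -> V u -> V v -> V (a *: u + b *: v).
Proof.
move=> cV a0 b0 ab1 Vu Vv; have a1 : a <= 1 by rewrite -ab1 lerDl.
have -> : b = 1 - a by lra.
exact/set_mem/(cV u v (Itv01 a0 a1) (mem_set Vu) (mem_set Vv)).
Qed.

Definition gauge_values V x : set R := [set t | 0 < t /\ V (t^-1 *: x)].

Definition gauge V x : R := inf (gauge_values V x).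

Lemma has_inf_gauge_values V x : nbhs 0 V -> has_inf (gauge_values V x).
Proof.
move=> V0; split; first by have [t t0 Vt] := nbhs0_absorbing x V0; exists t.
by exists 0 => t [/ltW].
Qed.

Lemma gauge_sublinear V : nbhs 0 V -> convex_set V -> sublinear (gauge V).
Proof.
move=> V0 cV; apply: inf_sublinear => [x|x y s t [s0 Vs] [t0 Vt]|].
- exact: has_inf_gauge_values.
- exists (s + t) => //; have st0 : 0 < s + t by exact: addr_gt0.
  split=> //; rewrite [_ *: _](_ : _ = (s / (s + t)) *: (s^-1 *: x)
      + (t / (s + t)) *: (t^-1 *: y)).
    apply: convex_comb => //; [exact/ltW/divr_gt0|exact/ltW/divr_gt0|].
    by rewrite -mulrDl divff// gt_eqF.
  by rewrite !scalerA scalerDr; congr (_ *: _ + _ *: _); field;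
    rewrite ?gt_eqF.
- move=> a x s a0 [s0 Vs]; exists (a * s) => //; split; first exact: mulr_gt0.
  by rewrite scalerA invfM mulrAC mulVf ?mul1r// gt_eqF.
Qed.

Lemma gauge_le1 V u : nbhs 0 V -> V u -> gauge V u <= 1.
Proof.
move=> V0 Vu; apply: (ge_inf (has_inf_gauge_values u V0).2).
by split; rewrite ?invr1 ?scale1r.
Qed.

Lemma gauge_ge1 V u : nbhs 0 V -> convex_set V -> ~ V u -> 1 <= gauge V u.
Proof.
move=> V0 cV Vu; apply: lb_le_inf => [|t [t0 Vt]].
  exact: (has_inf_gauge_values u V0).1.
rewrite leNgt; apply/negP => t1; apply: Vu.
rewrite (_ : u = t *: (t^-1 *: u) + (1 - t) *: 0).
  by apply: convex_comb => //; [exact: ltW|lra|lra|exact: nbhs_singleton].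
by rewrite scaler0 addr0 scalerA divff ?scale1r// gt_eqF.
Qed.

(** Hahn-Banach for the gauge of [V], which is at most [1] on [V] and at least
[1] off [V]. *)
Lemma convex_nbhs_separation V u : nbhs 0 V -> convex_set V -> ~ V u ->
  exists2 l : {linear E -> R^o}, (forall v, V v -> l v <= 1) & 1 <= l u.
Proof.
move=> V0 cV Vu; have [l lV lu] := hahn_banach u (gauge_sublinear V0 cV).
exists l => [v Vv|]; first exact: le_trans (lV v) (gauge_le1 V0 Vv).
exact: le_trans (gauge_ge1 V0 cV Vu) lu.
Qed.

(** The functionals bounded above by [1] on [V] are bounded above by [e / 2] on
[(e / 2) *: V], so a single neighbourhood of [x], cut out by this set and its
opposite, serves all of them. *)
Lemma polar_equicontinuous V x (e : R) : nbhs 0 V -> 0 < e ->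
  \forall v \near x, forall l : {linear E -> R^o},
    (forall w, V w -> l w <= 1) -> `|l x - l v| < e.
Proof.
move=> V0 e0; have k0 : 0 < 2 / e by rewrite divr_gt0.
near=> v => l lV.
have le_small (a b : E) : V ((2 / e) *: (a - b)) -> l a - l b < e.
  move=> /lV; rewrite linearZ/= linearB/= => h.
  have : (2 / e) * (l a - l b) <= 1 by [].
  by rewrite -ler_pdivlMl// mulr1 invf_div; lra.
rewrite ltr_norml ltrNl opprB; apply/andP; split; apply: le_small.
  near: v; exact: cvg_scale_sub V0.
rewrite -opprB scalerN -scaleNr; near: v; exact: cvg_scale_sub V0.
Unshelve. all: by end_near. Qed.

Lemma polar_continuous V (l : {linear E -> R^o}) : nbhs 0 V ->
  (forall w, V w -> l w <= 1) -> continuous l.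
Proof.
move=> V0 lV x; apply/(@cvgrPdist_lt R R^o) => e e0.
near=> v; have := lV; move: (l); near: v.
exact: polar_equicontinuous.
Unshelve. all: by end_near. Qed.

Lemma convex_nbhs_sub (A : set E) : nbhs 0 A ->
  exists V, [/\ nbhs 0 V, convex_set V & V `<=` A].
Proof.
have [B cB [Bo Bb]] := @locally_convex R E.
move=> /Bb[V [BV V0] VA]; exists V; split=> //.
  by apply: open_nbhs_nbhs; split=> //; exact: Bo.
by apply: cB; rewrite inE.
Qed.

End convex_neighbourhoods.

(** * Finite support of the continuous functionals on C_p(X) *)

Section Cp_dual.
Context (R : realType) (X : topologicalType).
Implicit Types (f g : Cp R X) (x : X).

Lemma Cp_eval_continuous x : continuous (fun f : Cp R X => f x).
Proof.
move=> f; apply: (@continuous_comp _ _ _ (@Cp_fun R X) (proj x)).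
  exact: initial_continuous.
exact: (@proj_continuous X (fun=> R)).
Qed.

Lemma Cp_sum_continuous (s : seq (R * X)) :
  continuous (fun f : Cp R X => \sum_(q <- s) q.1 * f q.2).
Proof.
elim: s => [|q s IH].
  rewrite (_ : (fun _ => _) = fun=> 0); first exact: cst_continuous.
  by apply/funext => g; rewrite big_nil.
rewrite (_ : (fun _ => _) =
    fun f : Cp R X => q.1 * f q.2 + \sum_(j <- s) j.1 * f j.2); last first.
  by apply/funext => g; rewrite big_cons.
move=> f; have nbhsf : Filter (nbhs f) by exact: nbhs_filter.
exact: (cvgD (cvgM (cvg_cst q.1) (@Cp_eval_continuous q.2 f)) (IH f)).
Qed.

Lemma Cp_cvg (F : set_system (Cp R X)) f : Filter F ->
  (forall x, (fun g : Cp R X => g x) @ F --> f x) -> F --> f.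
Proof.
move=> FF Ff A /= [_ [[B oB <-] Bf BA]].
have /pointwise_cvgP FB : forall x, (fun g : {ptws X -> R} => g x)
    @ (@Cp_fun R X @ F) --> Cp_fun f x by [].
by apply: filterS BA _; apply: FB; exact: open_nbhs_nbhs.
Qed.

Lemma Cp_map_continuous (E : topologicalType) (h : E -> Cp R X) :
  (forall x, continuous (fun u => h u x)) -> continuous h.
Proof. by move=> hc u; apply: Cp_cvg => x; exact: hc. Qed.

(** The sets that contain such a cylinder form a filter converging pointwise to
[f], hence they include every neighbourhood of [f]. *)
Lemma Cp_nbhs_finite f (A : set (Cp R X)) : nbhs f A ->
  exists (s : seq X) (e : R), 0 < e /\
    forall g, (forall x, x \in s -> `|f x - g x| < e) -> A g.
Proof.
pose F : set_system (Cp R X) := [set A : set (Cp R X) |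
  exists (s : seq X) (e : R), 0 < e /\
    forall g, (forall x, x \in s -> `|f x - g x| < e) -> A g].
have FF : Filter F.
  split; first by exists [::], 1.
    move=> B C [s [e [e0 sB]]] [t [d [d0 tC]]].
    exists (s ++ t), (Num.min e d); rewrite lt_min e0 d0; split=> // g stg.
    split; [apply: sB => x xs|apply: tC => x xt].
      by have := stg x; rewrite mem_cat xs lt_min => /(_ isT)/andP[].
    by have := stg x; rewrite mem_cat xt orbT lt_min => /(_ isT)/andP[].
  by move=> B C BC [s [e [e0 sB]]]; exists s, e; split=> // g /sB /BC.
suff : F --> f by exact.
apply: Cp_cvg => x; apply/cvgrPdist_lt => e e0.
by exists [:: x], e; split=> // g; apply; rewrite inE.
Qed.

(** A functional vanishing on the common kernel of finitely many evaluations is a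
combination of them.  In the induction on [s], if some [f1] vanishes on [s] but
not at [x], subtracting the multiple of the evaluation at [x] that kills [f1]
leaves a functional controlled by [s] alone; otherwise [x] is redundant. *)
Lemma eval_span (s : seq X) (h : {linear Cp R X -> R^o}) :
  (forall f, (forall x, x \in s -> f x = 0) -> h f = 0) ->
  exists t : seq (R * X), forall f, h f = \sum_(p <- t) p.1 * f p.2.
Proof.
elim: s h => [h h0|x s IH h h0]; first by exists [::] => f; rewrite big_nil h0.
have [[f1 f1s f1x]|nf1] := pselect
    (exists2 f1 : Cp R X, forall y, y \in s -> f1 y = 0 & f1 x != 0); last first.
  apply: IH => f fs; apply: h0 => y; rewrite inE => /orP[/eqP->|/fs//].
  by apply/eqP/negPn/negP => fx; apply: nf1; exists f.
pose c := h f1 / f1 x.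
have lin : linear_for *:%R (fun f => h f - f x * c : R^o).
  move=> a f g; rewrite linearP/= [(_ + _ : Cp R X) x]/= /mkcts/=.
  by rewrite /GRing.scale/=; ring.
pose h' := HB.pack_for {linear Cp R X -> R^o} (fun f => h f - f x * c : R^o)
  (GRing.isLinear.Build R (Cp R X) R^o *:%R _ lin).
have [f fs|t ht] := IH h'.
  have : h (f - (f x / f1 x) *: f1) = 0.
    apply: h0 => y; rewrite inE => ys.
    have -> : (f - (f x / f1 x) *: f1) y = f y - f x / f1 x * f1 y by [].
    case/orP: ys => [/eqP->|ys]; first by rewrite divfK ?subrr.
    by rewrite (fs y ys) (f1s y ys) mulr0 subrr.
  rewrite linearB linearZ/= => /eqP; rewrite subr_eq0 => /eqP ->.
  by rewrite /c /GRing.scale/=; apply/eqP; rewrite subr_eq0; apply/eqP; ring.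
exists ((c, x) :: t) => f; rewrite big_cons/= -ht/=; ring.
Qed.

(** Continuity bounds [h] by [1] on a cylinder over a finite set [s], and a linear
[h] bounded on all multiples of a function vanishing on [s] is [0] there. *)
Lemma Cp_dual_finite (h : {linear Cp R X -> R^o}) : continuous h ->
  exists t : seq (R * X), forall f, h f = \sum_(p <- t) p.1 * f p.2.
Proof.
move=> hc.
have h1 : nbhs (0 : Cp R X) [set f | `|h f| < 1].
  have /(@cvgrPdist_lt R R^o) := hc 0; rewrite linear0 => /(_ _ ltr01).
  by apply: filterS => f /=; rewrite sub0r normrN.
have [s [e [e0 sh]]] := Cp_nbhs_finite h1.
apply: (@eval_span s) => f fs; apply/eqP; rewrite -normr_eq0; apply/negPn/negP.
move=> hf0; have hf : 0 < `|h f| by rewrite lt_neqAle eq_sym hf0/=.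
have /= : `|h (`|h f|^-1 *: f)| < 1.
  apply: sh => x xs.
  have -> : (`|h f|^-1 *: f : Cp R X) x = `|h f|^-1 * f x by [].
  by rewrite fs// mulr0 subrr normr0.
by rewrite linearZ/= normrM normfV normr_id mulVf// ltxx.
Qed.

End Cp_dual.

(** * Adding a seminorm to a locally convex topology *)

Section adjoin_seminorm.
Context (R : realType) (E : tvsType R).

Definition seminorm (p : E -> R) : Prop :=
  (forall x y, p (x + y) <= p x + p y) /\
  (forall (a : R) x, p (a *: x) = `|a| * p x).

Variables (p : E -> R) (sp : seminorm p).

Lemma seminorm0 : p 0 = 0.
Proof. by rewrite -(scale0r (0 : E)) sp.2 normr0 mul0r. Qed.

Lemma seminormN x : p (- x) = p x.
Proof. by rewrite -scaleN1r sp.2 normrN1 mul1r. Qed.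

Lemma seminorm_ge0 x : 0 <= p x.
Proof. have := sp.1 x (- x); rewrite subrr seminorm0 seminormN; lra. Qed.

Lemma seminorm_scale_sub (a b : R) (x z : E) :
  p (b *: z - a *: x) <= `|b| * p (z - x) + `|a - b| * p x.
Proof.
rewrite (_ : _ - _ = b *: (z - x) + (b - a) *: x); last first.
  by rewrite scalerBr scalerBl addrA subrK.
by apply: le_trans (sp.1 _ _) _; rewrite !sp.2 distrC.
Qed.

Lemma seminorm_convex (a : R) (x u v : E) : 0 <= a -> a <= 1 ->
  p (a *: u + (1 - a) *: v - x) <= a * p (u - x) + (1 - a) * p (v - x).
Proof.
move=> a0 a1; rewrite (_ : _ - x = a *: (u - x) + (1 - a) *: (v - x)).
  apply: le_trans (sp.1 _ _) _.
  by rewrite !sp.2 !ger0_norm ?subr_ge0.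
rewrite !scalerBr addrACA -opprD -scalerDl addrC [a + _]addrC subrK.
by rewrite scale1r addrC.
Qed.

(** The space [E] with the coarsest linear topology finer than the given one for
which [p] is continuous.  The proof that [p] is a seminorm is an argument of the alias
so that the structures declared on the alias can depend on it. *)
Definition adjoin of seminorm p : Type := E.

Local Notation E' := (adjoin sp).

HB.instance Definition _ := GRing.Lmodule.on E'.

Definition adjoin_nbhs (x : E') : set_system E' := [set A |
  exists (U : set E) (e : R), [/\ nbhs (x : E) U, 0 < e &
    forall z : E, U z -> p (z - x) < e -> A z]].

HB.instance Definition _ := hasNbhs.Build E' adjoin_nbhs.

Lemma adjoin_nbhs_filter (x : E') : ProperFilter (nbhs x).
Proof.
split.
  move=> [U [e [Ux e0 UA]]]; apply: (UA x); first exact: nbhs_singleton Ux.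
  by rewrite subrr seminorm0.
split; first by exists setT, 1; split=> //; exact: filterT.
  move=> A B [U [e [Ux e0 UA]]] [V [d [Vx d0 VB]]].
  exists (U `&` V), (Num.min e d); rewrite lt_min e0 d0; split=> //.
    exact: filterI.
  by move=> z [Uz Vz]; rewrite lt_min => /andP[ze zd]; split;
    [exact: UA|exact: VB].
move=> A B AB [U [e [Ux e0 UA]]]; exists U, e; split=> // z Uz ze.
exact/AB/UA.
Qed.

Lemma adjoin_nbhs_singleton (x : E') (A : set E') : nbhs x A -> A x.
Proof.
move=> [U [e [Ux e0 UA]]]; apply: UA; first exact: nbhs_singleton Ux.
by rewrite subrr seminorm0.
Qed.

Lemma adjoin_nbhs_nbhs (x : E') (A : set E') :
  nbhs x A -> nbhs x (fun y => nbhs y A).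
Proof.
move=> [U [e [Ux e0 UA]]].
exists (fun y => nbhs y U), (e / 2); split.
- exact: nbhs_interior Ux.
- by rewrite divr_gt0.
move=> y Uy yx; exists U, (e / 2); split=> //; first by rewrite divr_gt0.
move=> z Uz zy; apply: UA => //.
rewrite (_ : z - x = (z - y) + (y - x)); last by rewrite addrA subrK.
have := sp.1 (z - y) (y - x); lra.
Qed.

HB.instance Definition _ := Nbhs_isNbhsTopological.Build E'
  adjoin_nbhs_filter adjoin_nbhs_singleton adjoin_nbhs_nbhs.

Lemma nbhs_adjoin (x : E) (U : set E) : nbhs x U -> nbhs (x : E') U.
Proof. by move=> Ux; exists U, 1; split. Qed.

Lemma nbhs_adjoin_ball (x : E) (e : R) : 0 < e ->
  nbhs (x : E') [set z : E | p (z - x) < e].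
Proof. by move=> e0; exists setT, e; split=> //; exact: filterT. Qed.

Lemma adjoin_add_continuous : continuous (fun x : E' * E' => x.1 + x.2).
Proof.
move=> [x y] A [U [e [Uxy e0 UA]]].
have [[S T]/= [Sx Ty] STU] := @add_continuous E (x, y) _ Uxy.
have e20 : 0 < e / 2 by rewrite divr_gt0.
exists ([set z : E' | S z /\ p ((z : E) - x) < e / 2],
        [set z : E' | T z /\ p ((z : E) - y) < e / 2]).
  by split; apply: filterI (nbhs_adjoin _) (nbhs_adjoin_ball _ e20).
move=> [z w] /= [[Sz zx] [Tw wy]]; apply: UA; first exact: (STU (z, w)).
rewrite (_ : _ - _ = ((z : E) - x) + ((w : E) - y)); last first.
  by rewrite opprD addrACA.
have := sp.1 ((z : E) - x) ((w : E) - y); lra.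
Qed.

Lemma adjoin_scale_continuous : continuous (fun z : R^o * E' => z.1 *: z.2).
Proof.
move=> [a x] A [U [e [Uax e0 UA]]].
have [[S T]/= [Sa Tx] STU] := @scale_continuous R E (a, x) _ Uax.
pose d := e / 2 / (p x + 1); pose k := e / 2 / (`|a| + 1).
have px := seminorm_ge0 x.
have d0 : 0 < d by rewrite !divr_gt0// ltr_wpDl.
have k0 : 0 < k by rewrite !divr_gt0// ltr_wpDl.
exists ([set b : R^o | S b /\ `|a - b| < Num.min 1 d],
        [set z : E' | T z /\ p ((z : E) - x) < k]).
  split; last exact: filterI (nbhs_adjoin _) (nbhs_adjoin_ball _ k0).
  apply: filterI => //; apply/nbhs_ballP; exists (Num.min 1 d) => //=.
  by rewrite lt_min ltr01.
move=> [b z] /= [[Sb ab] [Tz zx]]; apply: UA; first exact: (STU (b, z)).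
move: ab; rewrite lt_min => /andP[ab1 abd].
apply: le_lt_trans (seminorm_scale_sub a b x z) _.
have bk : `|b| * p ((z : E) - x) <= (`|a| + 1) * k.
  apply: ler_pM => //; [exact: seminorm_ge0| |exact: ltW].
  by have := ler_normB a (a - b); rewrite subKr; lra.
have dx : `|a - b| * p x <= d * p x by rewrite ler_wpM2r// ltW.
have dd : d * (p x + 1) = e / 2 by rewrite /d divfK// gt_eqF// ltr_wpDl.
have kk : (`|a| + 1) * k = e / 2 by rewrite mulrC /k divfK// gt_eqF// ltr_wpDl.
nra.
Qed.

Lemma adjoin_locally_convex :
  exists2 B : set_system E', (forall b, b \in B -> convex_set b) & basis B.
Proof.
have [B cB [Bo Bb]] := @locally_convex R E.
pose ball x e : set E := [set z | p (z - x) < e].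
exists [set b | exists V x (e : R), [/\ B V, 0 < e & b = V `&` ball x e]].
  move=> b /[!inE] -[V [x [e [BV e0 ->]]]] u v l /[!inE] -[Vu xu] [Vv xv].
  split.
    have /cB cV : V \in B by rewrite inE.
    exact/set_mem/(cV u v l (mem_set Vu) (mem_set Vv)).
  have l0 : 0 <= l%:num by [].
  have l1 : l%:num <= 1 by [].
  apply: le_lt_trans (seminorm_convex x u v l0 l1) _.
  move: xu xv; rewrite /ball/= => xu xv.
  by have [uv|/ltW vu] := leP (p ((u : E) - x)) (p ((v : E) - x)); nra.
split=> [_ [V [x [e [BV e0 ->]]]]|x A [U [e [Ux e0 UA]]]].
  rewrite openE => z [Vz zx]; rewrite /interior.
  exists V, (e - p (z - x)); split.
  - by apply: open_nbhs_nbhs; split=> //; exact: Bo.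
  - by rewrite subr_gt0.
  move=> w Vw wz; split=> //; rewrite /ball/=.
  rewrite (_ : w - x = (w - z) + (z - x)); last by rewrite addrA subrK.
  have := sp.1 (w - z) (z - x); lra.
have [V [BV Vx] VU] := Bb _ _ Ux.
exists (V `&` ball x e); last by move=> z [/VU Uz zx]; exact: UA.
split; first by exists V, x, e.
by split=> //; rewrite /ball/= subrr seminorm0.
Qed.

(* The first instance derives the uniform structure from the topology; the
   compatibility with the linear structure and local convexity come on top. *)
HB.instance Definition _ := PreTopologicalLmod_isTvs.Build R E'
  adjoin_add_continuous adjoin_scale_continuous adjoin_locally_convex.
HB.instance Definition _ :=
  PreTopologicalNmodule_isTopologicalNmodule.Build E' adjoin_add_continuous.
HB.instance Definition _ :=
  TopologicalNmodule_isTopologicalLmodule.Build R E' adjoin_scale_continuous.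
HB.instance Definition _ := Uniform_isTvs.Build R E' adjoin_locally_convex.

Lemma adjoin_hausdorff : hausdorff_space E -> hausdorff_space E'.
Proof.
move=> hE x y xy; apply: hE => A B Ax By.
by apply: xy; exact: nbhs_adjoin.
Qed.

End adjoin_seminorm.

(** * Continuous seminorms and functionals on a free locally convex space *)

Section free_lcs_seminorm.
Context (R : realType) (X : topologicalType) (L : free_lcs R X).

(** The hypothesis makes [free_delta L] continuous into [adjoin sp].  Its linear
extension fixes the points of [X], which span [L], so it is the identity; being
continuous into the finer topology, it gives the continuity of [p]. *)
Lemma free_seminorm_continuous (p : L -> R) : seminorm p ->
  (forall x (e : R), 0 < e ->
    \forall y \near x, p (free_delta L y - free_delta L x) < e) ->
  forall e : R, 0 < e -> nbhs 0 [set u | p u < e].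
Proof.
move=> sp dp e e0.
have dc : continuous (free_delta L : X -> adjoin sp).
  move=> x A [U [d [Ux d0 UA]]].
  have dU : \forall y \near x, U (free_delta L y).
    exact: (@free_delta_continuous _ _ L).
  by near=> y; apply: UA; near: y; [exact: dU|exact: dp].
have hE : hausdorff_space (adjoin sp).
  exact/adjoin_hausdorff/(@free_hausdorff _ _ L).
have [g gc gd] := @free_universal _ _ L (adjoin sp) hE _ dc.
(* [g] fixes the spanning set, so its continuity compares two topologies on the
   same space *)
have gid u : g u = u.
  have [s ->] := Defs.free_span u; rewrite linear_sum.
  by apply: eq_bigr => q _; rewrite linearZ/= gd.
have := gc 0 [set u : adjoin sp | p u < e].
rewrite linear0 => h; have {h} : nbhs (0 : L) (g @^-1` [set u | p u < e]).
  apply: h; have := nbhs_adjoin_ball sp 0 e0.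
  by apply: filterS => z /=; rewrite subr0.
by apply: filterS => u; rewrite /= gid.
Unshelve. all: by end_near. Qed.

End free_lcs_seminorm.

Section Cp_bounded.
Context (R : realType) (X : topologicalType).
Implicit Types (B : set (Cp R X)).

Lemma Cp_equicontinuousP B : equicontinuous B (@Cp_fun R X) <->
  forall x (e : R), 0 < e ->
    \forall y \near x, forall f : Cp R X, B f -> `|f x - f y| < e.
Proof.
split=> [eB x e e0|eB x D].
  have := eB x [set z : R * R | `|z.1 - z.2| < e].
  by apply; rewrite -entourage_ballE; exists e.
rewrite -entourage_ballE => -[e /= e0 eD].
by apply: filterS (eB x e e0) => y fe f /fe fxy; exact: eD.
Qed.

Lemma bounded_realP (A : set R) :
  bounded_set A <-> exists M : R, forall t, A t -> `|t| <= M.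
Proof.
split=> [[M [_ MA]]|[M MA]].
  by exists (M + 1) => t /(MA (M + 1)) -> //; rewrite ltrDl.
exists M; split; first exact: num_real.
by move=> K /ltW MK t /MA tM; exact: le_trans MK.
Qed.

End Cp_bounded.

Section free_lcs_dual.
Context (R : realType) (X : topologicalType) (L : free_lcs R X).
Implicit Types (f g : Cp R X) (B : set (Cp R X)) (V : set L).

Lemma free_ext_subproof f : exists2 l : {linear L -> R^o},
  continuous l & forall x, l (free_delta L x) = f x.
Proof.
apply: (@free_universal _ _ L R^o); first exact: Rhausdorff.
exact: (@cts_fun _ _ f).
Qed.

Definition free_ext f : {linear L -> R^o} := sval (cid2 (free_ext_subproof f)).

Lemma free_ext_continuous f : continuous (free_ext f).
Proof. by rewrite /free_ext; case: cid2. Qed.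

Lemma free_ext_delta f x : free_ext f (free_delta L x) = f x.
Proof. by rewrite /free_ext; case: cid2. Qed.

Lemma free_ext_sum f (s : seq (R * X)) :
  free_ext f (\sum_(q <- s) q.1 *: free_delta L q.2) = \sum_(q <- s) q.1 * f q.2.
Proof.
by rewrite linear_sum; apply: eq_bigr => q _; rewrite linearZ/= free_ext_delta.
Qed.

Lemma free_ext_linear (u : L) : linear_for *:%R (fun f => free_ext f u : R^o).
Proof.
move=> a f g; have [s ->] := Defs.free_span u; rewrite !free_ext_sum.
rewrite scaler_sumr -big_split; apply: eq_bigr => q _.
have -> : (a *: f + g : Cp R X) q.2 = a * f q.2 + g q.2 by [].
by rewrite /GRing.scale/=; ring.
Qed.

Lemma free_ext_unique (l : {linear L -> R^o}) f :
  (forall x, l (free_delta L x) = f x) -> l =1 free_ext f.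
Proof.
move=> lf u; have [s ->] := Defs.free_span u; rewrite free_ext_sum linear_sum.
by apply: eq_bigr => q _; rewrite linearZ/= lf.
Qed.

Lemma free_dual_ext (l : {linear L -> R^o}) : continuous l ->
  exists f, l =1 free_ext f.
Proof.
move=> lc; have ldc : continuous (fun x => l (free_delta L x) : R).
  move=> x; apply: (@continuous_comp _ _ _ (free_delta L) l).
    exact: free_delta_continuous.
  exact: lc.
by exists (mkcts ldc : Cp R X); exact: free_ext_unique.
Qed.

(** The value [0] is included so that the supremum is taken over a nonempty set even
when [B] is empty; for nonempty [B] it changes nothing, all other values being nonnegative. *)
Definition sup_values B (u : L) : set R :=
  [set t | t = 0 \/ exists2 f, B f & t = `|free_ext f u|].

(** Pointwise boundedness passes from the points of [X] to their finite
combinations. *)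
Lemma has_sup_values B u : equicontinuous_pointwise_bounded B ->
  has_sup (sup_values B u).
Proof.
move=> [_ bB]; split; first by exists 0; left.
suff [M M0 BM] : exists2 M, 0 <= M & forall f, B f -> `|free_ext f u| <= M.
  by exists M => t [->//|[f Bf ->]]; exact: BM.
have [s ->] := Defs.free_span u; elim: s => [|q s [M M0 BM]].
  by exists 0 => // f _; rewrite big_nil linear0 normr0.
have /bounded_realP[N BN] := bB q.2.
exists (`|q.1| * `|N| + M) => [|f Bf]; first by rewrite addr_ge0// mulr_ge0.
rewrite big_cons linearD linearZ/= free_ext_delta.
apply: le_trans (ler_normD _ _) _; rewrite lerD ?BM// normrM ler_wpM2l//.
apply: le_trans (ler_norm N); apply: BN; by exists f.
Qed.

Lemma sup_seminorm B : equicontinuous_pointwise_bounded B ->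
  seminorm (fun u => sup (sup_values B u)).
Proof.
move=> hB; have hs u := has_sup_values u hB.
have sup_ge f u : B f -> `|free_ext f u| <= sup (sup_values B u).
  by move=> Bf; apply: (ub_le_sup (hs u).2); right; exists f.
have sup_ge0 u : 0 <= sup (sup_values B u).
  by apply: (ub_le_sup (hs u).2); left.
have supZ (a : R) u : sup (sup_values B (a *: u)) <= `|a| * sup (sup_values B u).
  apply: ge_sup; first exact: (hs _).1.
  move=> _ [->|[f Bf ->]]; first by rewrite mulr_ge0.
  by rewrite linearZ/= normrM ler_wpM2l// sup_ge.
split=> [u v|a u].
  apply: ge_sup; first exact: (hs _).1.
  move=> _ [->|[f Bf ->]]; first by rewrite addr_ge0.
  by rewrite linearD (le_trans (ler_normD _ _))// lerD// sup_ge.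
apply/eqP; rewrite eq_le supZ/=; have [->|a0] := eqVneq a 0.
  by rewrite normr0 mul0r.
rewrite -ler_pdivlMl ?normr_gt0// -normfV.
by rewrite -{1}(scale1r u) -(mulVf a0) -scalerA supZ.
Qed.

(** Equicontinuity of [B] is exactly what makes [X -> L] continuous for the
seminorm [sup_(f in B) `|free_ext f u|]. *)
Lemma free_equicontinuous B (e : R) : equicontinuous_pointwise_bounded B ->
  0 < e -> nbhs (0 : L) [set u | forall f, B f -> `|free_ext f u| < e].
Proof.
move=> hB e0.
have hs u := has_sup_values u hB.
have := @free_seminorm_continuous _ _ L _ (sup_seminorm hB) _ e e0.
have h : forall x (d : R), 0 < d -> \forall y \near x,
    sup (sup_values B (free_delta L y - free_delta L x)) < d.
  move=> x d d0; have d20 : 0 < d / 2 by rewrite divr_gt0.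
  have /Cp_equicontinuousP /(_ x _ d20) := hB.1.
  apply: filterS => y By; apply: (@le_lt_trans _ _ (d / 2)); last by lra.
  apply: ge_sup; first exact: (hs _).1.
  move=> _ [->|[f Bf ->]]; first exact: ltW.
  by rewrite linearB/= !free_ext_delta distrC ltW// By.
move=> /(_ h); apply: filterS => u /= ue f Bf; apply: le_lt_trans ue.
by apply: (ub_le_sup (hs u).2); right; exists f.
Qed.

Definition polar V : set (Cp R X) :=
  [set f | forall v, V v -> free_ext f v <= 1].

(** Equicontinuity is that of the functionals bounded by [1] on [V], restricted to
[X]; pointwise bounds hold because [V] absorbs each [x] and its opposite. *)
Lemma polar_equicontinuous_bounded V : nbhs 0 V ->
  equicontinuous_pointwise_bounded (polar V).
Proof.
move=> V0; split.
  apply/Cp_equicontinuousP => x e e0.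
  have h : \forall y \near x, forall l : {linear L -> R^o},
      (forall w, V w -> l w <= 1) ->
      `|l (free_delta L x) - l (free_delta L y)| < e.
    exact: (@free_delta_continuous _ _ L x _
      (polar_equicontinuous (free_delta L x) V0 e0)).
  apply: (filterS _ h) => y hy f fV.
  by rewrite -(free_ext_delta f x) -(free_ext_delta f y); exact: hy.
move=> x; apply/bounded_realP.
have [s s0 Vs] := nbhs0_absorbing (free_delta L x) V0.
have [t t0 Vt] := nbhs0_absorbing (- free_delta L x) V0.
exists (s + t) => _ [f fV <-]; rewrite -(free_ext_delta f x).
have : s^-1 * free_ext f (free_delta L x) <= 1.
  by have := fV _ Vs; rewrite linearZ.
rewrite ler_pdivrMl// mulr1 => fs.
have : t^-1 * - free_ext f (free_delta L x) <= 1.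
  by have := fV _ Vt; rewrite linearZ/= linearN.
rewrite ler_pdivrMl// mulr1 => ft.
by rewrite ler_norml; apply/andP; split; lra.
Qed.

Lemma polar_separation V u : nbhs 0 V -> convex_set V -> ~ V u ->
  exists2 f, polar V f & 1 <= free_ext f u.
Proof.
move=> V0 cV /(convex_nbhs_separation V0 cV)[l lV lu].
have [f lf] := free_dual_ext (polar_continuous V0 lV).
by exists f; [move=> v /lV; rewrite lf|rewrite -lf].
Qed.

(** In a Hausdorff space some convex neighbourhood of [0] misses [u - v] when
[u <> v], and its polar then contains a function that tells [u] from [v]. *)
Lemma free_ext_separates (u v : L) :
  (forall f, free_ext f u = free_ext f v) -> u = v.
Proof.
move=> uv; apply/eqP/negPn/negP; rewrite -subr_eq0 => w0.
have /hausdorff_accessible /(_ 0 (u - v)) := @free_hausdorff _ _ L.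
rewrite eq_sym => /(_ w0) [A [oA /set_mem A0 wA]].
have [V [V0 cV VA]] : exists V, [/\ nbhs 0 V, convex_set V & V `<=` A].
  by apply: convex_nbhs_sub; exact: open_nbhs_nbhs.
have [|f _] := @polar_separation V (u - v) V0 cV.
  by move=> /VA; exact: (set_mem wA).
by rewrite linearB/= uv subrr; lra.
Qed.

End free_lcs_dual.

(** * Retractions of free spaces and extenders *)

Section retract.
Context (R : realType) (X : topologicalType) (Y : set X).
Context (LX : free_lcs R X) (LY : free_lcs R (set_type Y)).

(** An open [A] is the trace on [L(Y)] of [r @^-1` A]. *)
Lemma L_embedded_of_retraction (r : {linear LX -> LY}) :
  continuous r -> cancel (L_incl LX LY) r -> L_embedded LX LY.
Proof.
move=> rc rK; split=> [|A]; first exact: can_inj rK.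
split=> [oA|[B oB <-]].
  exists (r @^-1` A); first by move/continuousP : rc; exact.
  by apply/seteqP; split=> u /=; rewrite rK.
by have /continuousP := @L_incl_continuous _ _ _ LX LY; exact.
Qed.

(** The extender is the transpose [f |-> free_ext LY f (r x)] of the retraction. *)
Lemma retraction_extender : L_retract LX LY ->
  exists phi : {linear Cp R (set_type Y) -> Cp R X},
    [/\ continuous phi, extender phi &
      forall B : set (Cp R (set_type Y)),
        equicontinuous_pointwise_bounded B ->
        equicontinuous_pointwise_bounded (phi @` B)].
Proof.
move=> [_ [r rc rK]].
have rdc : continuous (fun x => r (free_delta LX x)).
  move=> x; apply: (@continuous_comp _ _ _ (free_delta LX) r).
    exact: free_delta_continuous.
  exact: rc.
have phic f : continuous (fun x => free_ext LY f (r (free_delta LX x)) : R).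
  move=> x; apply: (@continuous_comp _ _ _ (r \o free_delta LX) (free_ext LY f)).
    exact: rdc.
  exact: free_ext_continuous.
pose phi0 f : Cp R X := mkcts (phic f).
have phi0E f x : phi0 f x = free_ext LY f (r (free_delta LX x)) by [].
have lin : linear_for *:%R phi0.
  by move=> a f g; apply/Cp_funP => x; exact: free_ext_linear.
pose phi := HB.pack_for {linear Cp R (set_type Y) -> Cp R X} phi0
  (GRing.isLinear.Build R (Cp R (set_type Y)) (Cp R X) *:%R phi0 lin).
exists phi; split.
- apply: Cp_map_continuous => x.
  have [s rs] := Defs.free_span (r (free_delta LX x)).
  rewrite (_ : (fun f => phi f x) =
      fun f : Cp R (set_type Y) => \sum_(q <- s) q.1 * f q.2).
    exact: Cp_sum_continuous.
  by apply/funext => f; rewrite [LHS]phi0E rs free_ext_sum.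
- move=> f y; rewrite [LHS]phi0E.
  by rewrite -(L_incl_delta LX LY) rK free_ext_delta.
- move=> B hB; split.
    apply/Cp_equicontinuousP => x e e0.
    have h : \forall y \near x, forall f, B f -> `|free_ext LY f
        (1 *: (r (free_delta LX y) - r (free_delta LX x)))| < e.
      exact: rdc (cvg_scale_sub 1 _ (free_equicontinuous LY hB e0)).
    apply: (filterS _ h) => y hy _ [f Bf <-].
    by have := hy f Bf; rewrite scale1r linearB/= distrC.
  move=> x; apply/bounded_realP.
  have [_ [M BM]] := has_sup_values (r (free_delta LX x)) hB.
  by exists M => _ [_ [f Bf <-] <-]; apply: BM; right; exists f.
Qed.

(** [r0 x] represents the functional [f |-> phi f x] on [C_p(Y)]; the assumption on
[phi], applied to polars, is what makes [r0] continuous. *)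
Lemma extender_retraction (phi : {linear Cp R (set_type Y) -> Cp R X}) :
  continuous phi -> extender phi ->
  (forall B : set (Cp R (set_type Y)),
    equicontinuous_pointwise_bounded B ->
    equicontinuous_pointwise_bounded (phi @` B)) ->
  L_retract LX LY.
Proof.
move=> phic phiE phiB.
have /choice[r0 r0E] : forall x : X, exists u : LY,
    forall f, free_ext LY f u = phi f x.
  move=> x.
  have lin : linear_for *:%R (fun f => phi f x : R^o).
    by move=> a f g; rewrite linearP.
  pose h := HB.pack_for {linear Cp R (set_type Y) -> R^o}
    (fun f => phi f x : R^o)
    (GRing.isLinear.Build R (Cp R (set_type Y)) R^o *:%R _ lin).
  have [|t ht] := @Cp_dual_finite _ _ h.
    move=> f; apply: (@continuous_comp _ _ _ phi (fun g : Cp R X => g x)).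
      exact: phic.
    exact: Cp_eval_continuous.
  exists (\sum_(q <- t) q.1 *: free_delta LY q.2) => f.
  by rewrite free_ext_sum -ht.
have r0c : continuous r0.
  (* translate the neighbourhood A of r0 x to 0 in order to find V inside it *)
  move=> x A /(@nbhsB _ LY _ (r0 x) (- r0 x)); rewrite addNr => A0.
  have [V [V0 cV VA]] := convex_nbhs_sub A0.
  have /phiB[/Cp_equicontinuousP /(_ x 1 ltr01) near_x _] :=
    polar_equicontinuous_bounded V0.
  apply: filterS near_x => x' xx' /=.
  suff /VA[z Az] : V (r0 x' - r0 x) by rewrite addrC => /addIr <-.
  apply: contrapT => /(polar_separation V0 cV)[f fV].
  rewrite linearB/= !r0E.
  have := xx' (phi f) (ex_intro2 _ _ f fV erefl).
  rewrite distrC ltr_norml => /andP[_ lt1].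
  by apply/negP; rewrite -ltNge.
have [r rc rd] := free_universal LX (@free_hausdorff _ _ LY) r0c.
have rK : cancel (L_incl LX LY) r.
  move=> u; have [s ->] := Defs.free_span u; rewrite !linear_sum.
  apply: eq_bigr => q _; rewrite !linearZ/= L_incl_delta rd; congr (_ *: _).
  by apply: free_ext_separates => f; rewrite r0E free_ext_delta phiE.
by split; [exact: L_embedded_of_retraction rK|exists r].
Qed.

End retract.

Theorem theorem3p6 (R : realType) (X : topologicalType) (Y : set X)
    (hX : tychonoff_space X)
    (LX : free_lcs R X) (LY : free_lcs R (set_type Y)) :
  L_retract LX LY <->
  exists phi : {linear Cp R (set_type Y) -> Cp R X},
    [/\ continuous phi, extender phi &
      forall B : set (Cp R (set_type Y)),
        equicontinuous_pointwise_bounded B ->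
        equicontinuous_pointwise_bounded (phi @` B)].
Proof.
split; first exact: retraction_extender.
by move=> [phi [phic phiE phiB]]; exact: extender_retraction phiB.
Qed.
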